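(* Let $G:\mathbb{R}\to[0,1]$ be given by $G(t)=t\mathbf{1}_{[0,1)}(t)+\mathbf{1}_{[1,\infty)}(t)$, so that $\gamma$ is uniformly distributed on $(0,1)$ and $t_G=1$. Let $F \stackrel{\mathrm{loc}}{\ll} G$ be such that $\mathcal{M}^G F$ is a martingale on $[0, 1]$ which is not in $H^1$ (i.e. not an $H^1$-martingale on $[0,1]$). Suppose that $F$ is nondecreasing on $(0, 1)$ and satisfies $F(0) = 0$. Define the deterministic integrand $J = (J_t)_{t \in [0,1]}$ by $$J_t = \sum_{n = 0}^\infty \mathbf{1}_{( 1-2^{-2n},\, 1- 2^{-(2n+1)}]}(t).$$ Then the stochastic integral $J \bullet \mathcal{M}^G F$ is a strict local martingale on $[0,1]$.
   Context: Analytic setting (for the given $G$; here $\Delta G(t_G)=0$). Put $\overline{G}:=1-G$; $t\uparrow\uparrow t_G$ means $t\to t_G$ with $t<t_G$, and $F(v-)$ is the left limit of $F$ at $v$. $\mathrm{d}G$ is the Lebesgue--Stieltjes measure on $(0,\infty)$ induced by $G$. A Borel function $F:[0,\infty)\to\mathbb{R}$ satisfies $F\stackrel{\mathrm{loc}}{\ll}G$ if for every $0<b<t_G$ there is a $\mathrm{d}G$-integrable $f:(0,b]\to\mathbb{R}$ with $F(t)-F(0)=\int_{(0,t]}f(v)\,\mathrm{d}G(v)$ for all $t\in(0,b]$. Then there is a Borel function $\frac{\mathrm{d}F}{\mathrm{d}G}:(0,\infty)\to\mathbb{R}$ (local density), $\mathrm{d}G$-a.e. unique on $(0,t_G)$,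 which serves as such an $f$ for every $b\in(0,t_G)$. Define $\mathcal{A}^G F:(0,\infty)\to\mathbb{R}$ by $\mathcal{A}^G F(v)=F(v-)-\frac{\mathrm{d}F}{\mathrm{d}G}(v)\overline{G}(v)$ for $v\in(0,t_G)$; for $v\ge t_G$, $\mathcal{A}^G F(v)=F(t_G-)\mathbf{1}_{\{\Delta G(t_G)>0\}}$ if $F(t_G-):=\lim_{t\uparrow\uparrow t_G}F(t)$ exists in $\mathbb{R}$, and $\mathcal{A}^G F(v)=0$ otherwise (so here $\mathcal{A}^GF(v)=0$ for $v\ge 1$). Probabilistic setting. $(\Omega,\mathcal{F},P)$ is a probability space and $\gamma$ a $(0,\infty)$-valued random variable with distribution function $G$. The filtration considered is $\mathbb{F}^\gamma=(\mathcal{F}^\gamma_t)_{t\in[0,\infty]}$, $\mathcal{F}^\gamma_t=\sigma(\{\gamma\le s\}:s\in(0,t])$ (no usual conditions are assumed). The process $\mathcal{M}^G F=(\mathcal{M}^G_t F)_{t\in[0,\infty]}$ is $\mathcal{M}^G_tF=F(t)\mathbf{1}_{\{t<\gamma\}}+\mathcal{A}^G F(\gamma)\mathbf{1}_{\{t\ge\gamma\}}$. Since $\gamma<1$ a.s., $P$-a.e. path of $\mathcal{M}^GF$ is càdlàg and of finite variation on $[0,1]$, and $(J\bullet\mathcal{M}^GF)_t=\int_{(0,t]}J_u\,\mathrm{d}\mathcal{M}^G_uF$ is a pathwise Lebesgue--Stieltjes integral. Martingale terminology, for an interval $I=[0,T]$ and a filtration $\mathbb{F}$: a process $X$ is an $\mathbb{F}$-martingale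 on $I$ if $P$-a.e. path is càdlàg on $I$, $X$ is $\mathbb{F}$-adapted on $I$, $E[|X_t|]<\infty$ for all $t\in I$, and $E[X_t|\mathcal{F}_s]=X_s$ a.s. for all $s\le t$ in $I$. It is an $H^1$-$\mathbb{F}$-martingale on $I$ if in addition $E[\sup_{t\in I}|X_t|]<\infty$. $X$ is a local $\mathbb{F}$-martingale on $I=[0,T]$ if there is an increasing sequence of $\mathbb{F}$-stopping times $(\tau_n)$ with values in $[0,T]$ such that each stopped process $X^{\tau_n}$ is an $\mathbb{F}$-martingale on $I$ and $\lim_{n\to\infty}P[\tau_n=T]=1$. Without mention of a filtration, ''martingale'', ''$H^1$-martingale'', ''local martingale'' on $I$ mean that the property holds for some filtration of $\mathcal{F}$; a strict local martingale on $I$ is a local martingale on $I$ that is not a martingale on $I$. *)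

(* Defs.v *)
From HB Require Import structures.
From mathcomp Require Import all_boot all_order all_algebra.
From mathcomp Require Import all_classical all_reals all_analysis.
Import Order.TTheory GRing.Theory Num.Theory.
Import numFieldNormedType.Exports.

Set Implicit Arguments.
Unset Strict Implicit.
Unset Printing Implicit Defensive.

Local Open Scope classical_set_scope.
Local Open Scope ring_scope.

Section martingales.
Context {R : realType} {d : measure_display} {Omega : measurableType d}.
Variable P : probability Omega R.

(* Processes and filtrations are indexed by R; only times t >= 0 matter. *)
Implicit Types (X : R -> Omega -> R) (Fs : R -> set (set Omega)).

Definition is_filtration Fs : Prop :=
  [/\ forall t, 0 <= t -> sigma_algebra [set: Omega] (Fs t),
      forall t, 0 <= t -> Fs t `<=` measurable
    & forall s t, 0 <= s -> s <= t -> Fs s `<=` Fs t].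

Definition measurable_wrt (S : set (set Omega)) (Y : Omega -> R) : Prop :=
  forall B : set R, measurable B -> S (Y @^-1` B).

(* Y is a version of E[X | S]. *)
Definition is_cond_exp (S : set (set Omega)) (X Y : Omega -> R) : Prop :=
  [/\ measurable_wrt S Y,
      P.-integrable [set: Omega] (EFin \o Y)
    & forall A, S A ->
        (\int[P]_(w in A) (Y w)%:E = \int[P]_(w in A) (X w)%:E)%E].

Definition cadlag_on (T : R) (x : R -> R) : Prop :=
  (forall t, 0 <= t < T -> x u @[u --> t^'+] --> x t) /\
  (forall t, 0 < t <= T -> cvg (x u @[u --> t^'-])).

Definition martingale_wrt Fs (T : R) X : Prop :=
  [/\ {ae P, forall w, cadlag_on T (X ^~ w)},
      forall t, 0 <= t <= T -> measurable_wrt (Fs t) (X t),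
      forall t, 0 <= t <= T -> P.-integrable [set: Omega] (EFin \o X t)
    & forall s t, 0 <= s -> s <= t -> t <= T ->
        exists Y, is_cond_exp (Fs s) (X t) Y /\ {ae P, forall w, Y w = X s w}].

(* For an a.s. cadlag process the supremum is measurable only up to a P-null
   set, which is harmless: the integral of a nonnegative function is the
   supremum of the integrals of the simple functions below it. *)
Definition H1_martingale_wrt Fs (T : R) X : Prop :=
  martingale_wrt Fs T X /\
  (\int[P]_w ereal_sup
     [set (`|X t w|%R)%:E | t in [set t : R | (0 <= t <= T)%R]] < +oo)%E.

Definition stopping_time Fs (tau : Omega -> R) : Prop :=
  forall t, 0 <= t -> Fs t [set w | tau w <= t].

Definition stopped X (tau : Omega -> R) : R -> Omega -> R :=
  fun t w => X (Num.min t (tau w)) w.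

Definition local_martingale_wrt Fs (T : R) X : Prop :=
  exists tau : nat -> Omega -> R,
    [/\ forall n w, 0 <= tau n w <= T,
        forall n w, tau n w <= tau n.+1 w,
        forall n, stopping_time Fs (tau n),
        forall n, martingale_wrt Fs T (stopped X (tau n))
      & P [set w | tau n w = T] @[n --> \oo] --> 1%E].

Definition martingale (T : R) X : Prop :=
  exists Fs, is_filtration Fs /\ martingale_wrt Fs T X.

Definition H1_martingale (T : R) X : Prop :=
  exists Fs, is_filtration Fs /\ H1_martingale_wrt Fs T X.

Definition local_martingale (T : R) X : Prop :=
  exists Fs, is_filtration Fs /\ local_martingale_wrt Fs T X.

Definition strict_local_martingale (T : R) X : Prop :=
  local_martingale T X /\ ~ martingale T X.

End martingales.

Section stieltjes.
Context {R : realType}.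

(* v = \int_(0, t] J dx, for a path x that is cadlag and of finite variation on
   [0, t], i.e. a difference there of two nondecreasing right-continuous
   functions; v does not depend on the decomposition. *)
Definition is_LS_integral (J x : R -> R) (t v : R) : Prop :=
  exists p q : cumulative R R,
    [/\ forall u, 0 <= u <= t -> x u = p u - q u,
        (lebesgue_stieltjes_measure p).-integrable `]0, t] (EFin \o J),
        (lebesgue_stieltjes_measure q).-integrable `]0, t] (EFin \o J)
      & v = \int[lebesgue_stieltjes_measure p]_(u in `]0, t]) J u
          - \int[lebesgue_stieltjes_measure q]_(u in `]0, t]) J u].

(* Set to 0 when x is not cadlag and of finite variation on [0, t]. *)
Definition LS_integral (J x : R -> R) (t : R) : R :=
  xget 0 [set v | is_LS_integral J x t v].

Definition stoch_integral {Omega : Type} (J : R -> R) (X : R -> Omega -> R) :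
    R -> Omega -> R :=
  fun t w => LS_integral J (X ^~ w) t.

End stieltjes.

Section single_jump.
Context {R : realType}.
Implicit Types (G : cumulative R R) (F f : R -> R).

Local Notation dG G := (lebesgue_stieltjes_measure G).

(* The right endpoint t_G of the distribution function G. *)
Definition right_endpoint G : \bar R :=
  ereal_sup [set t%:E | t in [set t | G t < 1]].

Definition left_lim F (v : R) : R := lim (F u @[u --> v^'-]).

Definition is_density_upto G F (b : R) f : Prop :=
  (dG G).-integrable `]0, b] (EFin \o f) /\
  (forall t, 0 < t <= b -> F t - F 0 = \int[dG G]_(v in `]0, t]) f v).

Definition loc_abs_cont G F : Prop :=
  measurable_fun (`[0, +oo[ : set R) F /\
  forall b : R, 0 < b -> (b%:E < right_endpoint G)%E ->
    exists f, is_density_upto G F b f.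

(* f is a version of dF/dG. *)
Definition is_local_density G F f : Prop :=
  measurable_fun (`]0, +oo[ : set R) f /\
  forall b : R, 0 < b -> (b%:E < right_endpoint G)%E ->
    is_density_upto G F b f.

(* A^G F, where f is the version of dF/dG in use. *)
Definition AG G F f (v : R) : R :=
  if (v%:E < right_endpoint G)%E then left_lim F v - f v * (1 - G v)
  else let tG := fine (right_endpoint G) in
    if `[< cvg (F u @[u --> tG^'-]) >]
    then left_lim F tG * (0 < G tG - left_lim G tG)%R%:R
    else 0.

Definition MG {Omega : Type} G F f (gamma : Omega -> R) : R -> Omega -> R :=
  fun t w => F t * (t < gamma w)%R%:R
           + AG G F f (gamma w) * (gamma w <= t)%R%:R.

End single_jump.

Section uniform.
Context {R : realType}.

Definition unifG (t : R) : R := t * \1_`[0, 1[ t + \1_`[1, +oo[ t.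

Lemma unifGE (t : R) : unifG t = Num.max 0 (Num.min t 1).
Proof.
rewrite /unifG !indicE !mem_setE !in_itv/= andbT.
have [t1|t1] := ltP t 1; have [t0|t0] := leP 0 t => /=.
- by rewrite mulr1 addr0.
- by rewrite mulr0 addr0.
- by rewrite mulr0 add0r (max_idPr ler01).
- by have := lt_le_trans t0 (le_trans ler01 t1); rewrite ltxx.
Qed.

Lemma unifG_nd : nondecreasing unifG.
Proof.
move=> x y xy; rewrite !unifGE ge_max le_max lexx/= le_max.
by rewrite le_min !ge_min xy lexx !orbT.
Qed.

Lemma unifG_rc : right_continuous unifG.
Proof.
apply: right_continuousW.
rewrite (_ : unifG = cst 0 \max (idfun \min cst 1)); last first.
  by apply/funext => t; rewrite unifGE.
apply: max_fun_continuous; first exact: cst_continuous.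
by apply: min_fun_continuous; [by move=> ?; exact: cvg_id|exact: cst_continuous].
Qed.

HB.instance Definition _ :=
  isCumulative.Build R _ R unifG unifG_nd unifG_rc.

Definition dyadicJ (t : R) : R :=
  limn (series (fun n : nat =>
    \1_`]1 - 2 ^- (2 * n), 1 - 2 ^- (2 * n).+1] t : R)).

End uniform.

(* Main.v *)
Require Import Defs.
From HB Require Import structures.
From mathcomp Require Import all_boot all_order all_algebra.
From mathcomp Require Import all_classical all_reals all_analysis.
From mathcomp Require Import measurable_realfun.
From mathcomp Require Import ring lra.
Import Order.TTheory GRing.Theory Num.Theory.
Import numFieldNormedType.Exports.

Set Implicit Arguments.
Unset Strict Implicit.
Unset Printing Implicit Defensive.

Local Open Scope classical_set_scope.
Local Open Scope ring_scope.

(** Write M for the process MG, a_k = 1 - 2^(-2k) and b_k = 1 - 2^(-(2k+1)), so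
    that J is the indicator function of the union of the intervals ]a_k, b_k],
    and N for the integral of J against M.

    The path of M is F before gamma and a constant A(gamma) from gamma on.
    Since J is a step function, N is a sum of increments,
      N_t = sum_k (M_(t /\ b_k) - M_(t /\ a_k)),
    and whenever t < 1 or gamma < 1 only finitely many terms are nonzero
    (LS_integral_jump_path).  Stopping M at deterministic times preserves the
    martingale property, so each finite partial sum is a martingale for the
    filtration of M.

    Local martingale.  The times to use are a_n on {a_n < gamma} and 1 on
    {gamma <= a_n}: they stop N to the n-th partial sum.  The filtration of M
    need not contain the events {a_n < gamma}, but it contains the events
    {M_(a_k) <> F(a_k)}, which imply gamma <= a_k; so tau_n is a_n as long as
    M_(a_k) = F(a_k) for all k <= n, and 1 otherwise.  On {gamma < 1} one has
    M_(a_n) = A(gamma) for n large, and this differs from F(a_n) eventually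
    because F is unbounded: otherwise M would be bounded by an integrable
    variable and hence in H^1 (unbounded_of_notH1).  Thus P(tau_n = 1) -> 1
    (local_martingale_stoch_integral).

    Strictness.  If N were a martingale for some filtration, N_1 would be
    integrable.  Put h_k = sum_(j < k) (F(b_j) - F(a_j)), a nondecreasing
    sequence.  Where b_k < gamma <= a_(k+1), one has N_1 = h_(k+1); where
    a_k < gamma <= b_k, one has N_1 = h_k + A(gamma) - F(a_k).  These two events
    have comparable probabilities, so the integrability of N_1 on the first
    kind controls the h_k, and then that of N_1 and M_1 = A(gamma) on the second
    kind controls the F(a_k): the series of the F(a_k) 2^(-2k) converges.  As F
    is nondecreasing and P(a_k < gamma <= a_(k+1)) equals
    3 * 2^(-2(k+1)), this makes the supremum of F over [0, gamma[ integrable, so M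
    is in H^1, a contradiction (H1_of_integrable_stoch_integral). *)

(** * Operations on martingales *)

Section closure.
Context {R : realType} {d : measure_display} {Omega : measurableType d}.
Variable P : probability Omega R.
Implicit Types (X Y : R -> Omega -> R) (Fs : R -> set (set Omega)).

(** Makes the closure properties of measurable functions available for a
    sub-sigma-algebra. *)
Lemma measurable_wrtP (S : set (set Omega)) (Y : Omega -> R) :
  sigma_algebra [set: Omega] S ->
  measurable_wrt S Y <->
  measurable_fun [set: g_sigma_algebraType S] (Y : g_sigma_algebraType S -> R).
Proof.
move=> sS; have SE : <<s S >> = S by exact: sigma_algebra_id.
split=> [mY _ B mB|mY B mB].
  by rewrite setTI; apply: sub_sigma_algebra; exact: mY.
by have := mY measurableT B mB; rewrite setTI /measurable/= SE.
Qed.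

Lemma cadlag_on_addZ (T c : R) (x y : R -> R) :
  cadlag_on T x -> cadlag_on T y -> cadlag_on T (fun t => x t + c * y t).
Proof.
move=> [xr xl] [yr yl]; split=> t tT.
  by apply: cvgD; [exact: xr|apply: cvgMr; exact: yr].
apply: is_cvgD; first exact: xl.
by apply: is_cvgMr; exact: yl.
Qed.

Lemma cadlag_on_stop (T c : R) (x : R -> R) :
  0 <= c -> cadlag_on T x -> cadlag_on T (fun t => x (Num.min t c)).
Proof.
move=> c0 [xr xl]; split=> t tT.
  have [tc|ct] := ltP t c.
    apply: cvg_trans (xr _ tT); apply: near_eq_cvg; near=> u.
    rewrite min_l//; near: u; exact: nbhs_right_le.
  apply: cvg_trans (@cvg_cst _ (x c) _ (t^'+) _).
  apply: near_eq_cvg; near=> u; rewrite min_r//.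
  by rewrite (le_trans ct)//; near: u; exact: nbhs_right_ge.
have [tc|ct] := leP t c.
  have := xl _ tT; rewrite !cvg_ex => -[l xtl]; exists l.
  apply: cvg_trans xtl; apply: near_eq_cvg; near=> u.
  by rewrite min_l// (le_trans _ tc)//; near: u; exact: nbhs_left_le.
rewrite cvg_ex; exists (x c).
apply: cvg_trans (@cvg_cst _ (x c) _ (t^'-) _).
apply: near_eq_cvg; near=> u; rewrite min_r//.
near: u; exact: nbhs_left_ge.
Unshelve. all: by end_near. Qed.

Lemma eq_cadlag_on (T : R) (x y : R -> R) :
  (forall t, 0 <= t <= T -> x t = y t) -> cadlag_on T x -> cadlag_on T y.
Proof.
move=> xy [xr xl]; split=> t /andP[t0 tT].
  rewrite -(xy t); last by rewrite t0 ltW.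
  apply: cvg_trans (xr t _); last by rewrite t0 tT.
  apply: near_eq_cvg; near=> u; rewrite xy//; apply/andP; split.
    by rewrite (le_trans t0)//; near: u; exact: nbhs_right_ge.
  near: u; exact: nbhs_right_le.
have := xl t; rewrite t0 tT => /(_ isT); rewrite !cvg_ex => -[l xtl]; exists l.
apply: cvg_trans xtl; apply: near_eq_cvg; near=> u; rewrite xy//.
apply/andP; split; first by near: u; exact: nbhs_left_ge.
by rewrite (le_trans _ tT)//; near: u; exact: nbhs_left_le.
Unshelve. all: by end_near. Qed.

(** The conditional expectation in the definition is only a version of [X s];
    since [X s] is itself adapted, the integrals may be compared directly. *)
Lemma martingale_wrt_eq_integral Fs T X s t A : martingale_wrt P Fs T X ->
  0 <= s -> s <= t -> t <= T -> Fs s A -> measurable A ->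
  (\int[P]_(w in A) (X s w)%:E = \int[P]_(w in A) (X t w)%:E)%E.
Proof.
move=> [_ _ iX mX] s0 st tT FA mA.
have [Y [[_ iY YA] YX]] := mX _ _ s0 st tT.
rewrite -YA//; apply: ae_eq_integral => //.
- apply: measurable_funS (measurable_int P (iX s _)) => //.
  by rewrite s0 (le_trans st).
- exact: measurable_funS (measurable_int P iY).
- by apply: filterS YX => w /= <-.
Qed.

Lemma martingale_wrt_intro Fs T X : is_filtration Fs ->
  {ae P, forall w, cadlag_on T (X ^~ w)} ->
  (forall t, 0 <= t <= T -> measurable_wrt (Fs t) (X t)) ->
  (forall t, 0 <= t <= T -> P.-integrable [set: Omega] (EFin \o X t)) ->
  (forall s t A, 0 <= s -> s <= t -> t <= T -> Fs s A ->
     (\int[P]_(w in A) (X s w)%:E = \int[P]_(w in A) (X t w)%:E)%E) ->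
  martingale_wrt P Fs T X.
Proof.
move=> Ffs cX mX iX eX; split=> // s t s0 st tT; exists (X s).
have sT : 0 <= s <= T by rewrite s0 (le_trans st).
split; last exact: aeW.
by split=> [||A FA]; [exact: mX|exact: iX|exact: eX].
Qed.

Lemma martingale_wrt_cst Fs T (c : R) : is_filtration Fs ->
  martingale_wrt P Fs T (fun=> cst c).
Proof.
move=> Ffs; apply: martingale_wrt_intro => //.
- apply: aeW => w; split=> t _; first exact: cvg_cst.
  exact: is_cvg_cst.
- move=> t /andP[t0 _]; case: Ffs => sF _ _.
  by apply/(measurable_wrtP _ (sF _ t0)); exact: measurable_cst.
- move=> t _; exact: finite_measure_integrable_cst.
Qed.

Lemma martingale_wrt_addZ Fs T (c : R) X Y : is_filtration Fs ->
  martingale_wrt P Fs T X -> martingale_wrt P Fs T Y ->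
  martingale_wrt P Fs T (fun t w => X t w + c * Y t w).
Proof.
move=> Ffs MX MY; case: (Ffs) => sF mF _.
case: (MX) => cX mX iX _; case: (MY) => cY mY iY _.
have iZ (A : set Omega) t : measurable A -> 0 <= t <= T ->
   (\int[P]_(w in A) (X t w + c * Y t w)%:E =
    \int[P]_(w in A) (X t w)%:E + c%:E * \int[P]_(w in A) (Y t w)%:E)%E.
  move=> mA tT; under eq_integral do rewrite EFinD EFinM.
  have iXA := integrableS measurableT mA (@subsetT _ _) (iX t tT).
  have iYA := integrableS measurableT mA (@subsetT _ _) (iY t tT).
  by rewrite integralD//= ?integralZl//; exact: integrableZl.
apply: martingale_wrt_intro => //.
- by apply: filterS2 cX cY => w; exact: cadlag_on_addZ.
- move=> t tT; have t0 : 0 <= t by case/andP: tT.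
  apply/(measurable_wrtP _ (sF _ t0)).
  apply: measurable_funD; first exact/(measurable_wrtP _ (sF _ t0))/mX.
  by apply: measurable_funM => //; exact/(measurable_wrtP _ (sF _ t0))/mY.
- move=> t tT.
  have := integrableD measurableT (iX t tT) (integrableZl measurableT c (iY t tT)).
  by apply: eq_integrable => // w _ /=; rewrite EFinD EFinM.
- move=> s t A s0 st tT FA; have mA := mF _ s0 _ FA.
  rewrite !iZ//; last 2 first.
  + by rewrite (le_trans s0).
  + by rewrite s0 (le_trans st).
  rewrite (martingale_wrt_eq_integral MX s0 st tT FA mA).
  by rewrite (martingale_wrt_eq_integral MY s0 st tT FA mA).
Qed.

(** Optional stopping for a constant time: for [s <= c] it is the martingale
    property between [s] and [min t c], and for [s > c] both sides are [X c]. *)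
Lemma martingale_wrt_stop Fs T (c : R) X : is_filtration Fs -> 0 <= c ->
  martingale_wrt P Fs T X ->
  martingale_wrt P Fs T (fun t => X (Num.min t c)).
Proof.
move=> Ffs c0 MX; case: (Ffs) => sF mF ndF; case: (MX) => cX mX iX _.
have tcT t : 0 <= t <= T -> 0 <= Num.min t c <= T.
  by move=> /andP[t0 tT]; rewrite le_min t0 c0/= ge_min tT.
apply: martingale_wrt_intro => //.
- by apply: filterS cX => w; exact: cadlag_on_stop.
- move=> t tT B mB; have /andP[t0 _] := tcT _ tT.
  apply: (ndF (Num.min t c)) => //; first by rewrite ge_min lexx.
  exact: mX (tcT _ tT) _ mB.
- by move=> t tT; exact: iX (tcT _ tT).
- move=> s t A s0 st tT FA.
  have [sc|cs] := leP s c; last by rewrite min_r// ltW// (lt_le_trans cs).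
  apply: (martingale_wrt_eq_integral MX) => //.
  + by rewrite le_min st sc.
  + by rewrite ge_min tT.
  + exact: mF FA.
Qed.

Lemma eq_martingale_wrt Fs T X Y : is_filtration Fs ->
  (forall t w, 0 <= t <= T -> X t w = Y t w) ->
  martingale_wrt P Fs T X -> martingale_wrt P Fs T Y.
Proof.
move=> Ffs XY [cX mX iX eX].
have XtY t : 0 <= t <= T -> X t = Y t by move=> tT; apply/funext => w; exact: XY.
split.
- apply: filterS cX => w; apply: eq_cadlag_on => t; exact: XY.
- by move=> t tT; rewrite -XtY//; exact: mX.
- by move=> t tT; rewrite -XtY//; exact: iX.
- move=> s t s0 st tT; rewrite -!XtY ?s0 ?(le_trans s0 st)// ?(le_trans st tT)//.
  exact: eX.
Qed.

Lemma martingale_wrt_sum Fs T (n : nat) (Z : nat -> R -> Omega -> R) :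
  is_filtration Fs -> (forall k, (k < n)%N -> martingale_wrt P Fs T (Z k)) ->
  martingale_wrt P Fs T (fun t w => \sum_(k < n) Z k t w).
Proof.
move=> Ffs; elim: n => [|n ih] MZ.
  apply: (eq_martingale_wrt Ffs _ (martingale_wrt_cst T 0 Ffs)) => t w _.
  by rewrite big_ord0.
have ihn := ih (fun k kn => MZ k (ltnW kn)).
have := martingale_wrt_addZ 1 Ffs ihn (MZ n (ltnSn n)).
by apply: eq_martingale_wrt => // t w _; rewrite big_ord_recr mul1r.
Qed.

End closure.

(** * The dyadic integrand *)

Section grid.
Context {R : realType}.

Definition grid (n : nat) : R := 1 - 2 ^- n.

Lemma grid0 : grid 0 = 0. Proof. by rewrite /grid expr0 invr1 subrr. Qed.

Lemma grid_lt1 n : grid n < 1.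
Proof. by rewrite /grid ltrBlDr ltrDl invr_gt0 exprn_gt0. Qed.

Lemma le_grid m n : (m <= n)%N -> grid m <= grid n.
Proof.
by move=> mn; rewrite /grid lerB// lef_pV2 ?posrE ?exprn_gt0// ler_weXn2l// ler1n.
Qed.

Lemma grid_ge0 n : 0 <= grid n.
Proof. by rewrite -grid0 le_grid. Qed.

Lemma cvg_grid : grid n @[n --> \oo] --> (1 : R).
Proof.
rewrite -[X in _ --> X]subr0; apply: cvgB; first exact: cvg_cst.
under eq_fun do rewrite -exprVn.
by apply: cvg_expr; rewrite ger0_norm ?invr_ge0// invf_lt1// ltr1n.
Qed.

Lemma grid_gt (t : R) : t < 1 -> exists n, t < grid n.
Proof.
move=> t1; have := cvgr_gt _ cvg_grid t t1.
by move=> [n _ /(_ n (leqnn n))]; exists n.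
Qed.

Lemma trivIset_itv_oc (a b : nat -> R) :
  {homo a : m n / (m <= n)%N >-> m <= n} -> (forall k, b k <= a k.+1) ->
  trivIset setT (fun k => `]a k, b k]%classic).
Proof.
move=> ndecr ba; apply/trivIsetP => i j _ _.
wlog ij : i j / (i < j)%N => [th|_].
  by rewrite neq_lt => /orP[|] ij; [|rewrite setIC]; apply: th => //; rewrite lt_eqF.
rewrite -subset0 => t [/=]; rewrite !in_itv/= => /andP[_ tb] /andP[ta _].
have := le_lt_trans tb (le_lt_trans (le_trans (ba i) (ndecr _ _ ij)) ta).
by rewrite ltxx.
Qed.

Lemma dyadicJE : dyadicJ =
  \1_(\bigcup_k `]grid (2 * k), grid (2 * k).+1]%classic) :> (R -> R).
Proof.
apply/funext => t; rewrite /dyadicJ.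
set I := fun k => `]grid (2 * k), grid (2 * k).+1]%classic.
have tI : trivIset setT I.
  apply: (@trivIset_itv_oc (fun k => grid (2 * k)) (fun k => grid (2 * k).+1)).
    by move=> m n mn; apply: le_grid; rewrite leq_mul2l mn.
  by move=> k; rewrite le_grid// mulnS.
apply/cvg_lim => //.
suff : EFin \o series (fun k => \1_(I k) t) @ \oo --> ((\1_(\bigcup_k I k) t : R)%:E)%E.
  by move=> /fine_cvg.
have -> : EFin \o series (fun k => \1_(I k) t) =
    (fun n => \sum_(0 <= k < n) (\1_(I k) t : R)%:E)%E.
  by apply/funext => n; rewrite /= /series/= -sumEFin.
by rewrite indic_bigcup//; apply: is_cvg_nneseries => n _ _; rewrite lee_fin.
Qed.

End grid.

(** * Integrals of the dyadic integrand *)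

Section dyadic_integral.
Context {R : realType}.

Lemma lebesgue_stieltjes_measure_itv (p : cumulative R R) (a b : R) : a <= b ->
  lebesgue_stieltjes_measure p `]a, b]%classic = (p b - p a)%:E.
Proof.
move=> ab; rewrite /lebesgue_stieltjes_measure /measure_extension/=.
by rewrite measurable_mu_extE/=; [rewrite wlength_itv_bnd|exact: is_ocitv].
Qed.

Definition dyadic_incr (x : R -> R) (t : R) (k : nat) : R :=
  x (Num.min t (grid (2 * k).+1)) - x (Num.min t (grid (2 * k))).

Let support_itv (t : R) : 0 <= t ->
  (\bigcup_k `]grid (2 * k), grid (2 * k).+1]%classic) `&` `]0, t]%classic =
  \bigcup_k `]Num.min t (grid (2 * k)), Num.min t (grid (2 * k).+1)]%classic.
Proof.
move=> t0; rewrite setI_bigcupl; apply: eq_bigcupr => k _.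
apply/seteqP; split=> u /=; rewrite !in_itv/=.
  by move=> [/andP[au ub] /andP[_ ut]]; rewrite gt_min au orbT le_min ut ub.
rewrite le_min => /andP[tau /andP[ut ub]].
have au : grid (2 * k) < u.
  by move: tau; rewrite gt_min ltNge ut.
by rewrite au ub ut andbT (le_lt_trans (grid_ge0 _) au).
Qed.

Let measurable_support :
  measurable (\bigcup_k `]grid (2 * k), grid (2 * k).+1]%classic : set R).
Proof. by apply: bigcupT_measurable => k; exact: measurable_itv. Qed.

Lemma integrable_dyadicJ (p : cumulative R R) (t : R) : 0 <= t ->
  (lebesgue_stieltjes_measure p).-integrable `]0, t] (EFin \o dyadicJ).
Proof.
move=> t0; rewrite dyadicJE; apply: measurable_bounded_integrable => //.
- have : (lebesgue_stieltjes_measure p `]0%R, t]%classic < +oo)%E.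
    by rewrite lebesgue_stieltjes_measure_itv// ltry.
  exact.
- exists 1; split=> // M M1 u _ /=; rewrite indicE.
  by rewrite ger0_norm// (le_trans _ (ltW M1))// lern1 leq_b1.
Qed.

(** The support of the integrand up to time [t] is a disjoint union of intervals
    whose measures are the increments of [p]. *)
Lemma cvg_dyadic_incr (p : cumulative R R) (t : R) : 0 <= t ->
  series (dyadic_incr p t) @ \oo -->
  \int[lebesgue_stieltjes_measure p]_(u in `]0, t]) dyadicJ u.
Proof.
move=> t0; set mu := lebesgue_stieltjes_measure p.
set I := fun k => `]Num.min t (grid (2 * k)), Num.min t (grid (2 * k).+1)]%classic.
have mI k : measurable (I k) by exact: measurable_itv.
have mU : measurable (\bigcup_k I k) by exact: bigcupT_measurable.
have tI : trivIset setT I.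
  apply: (@trivIset_itv_oc _ (fun k => Num.min t (grid (2 * k)))
    (fun k => Num.min t (grid (2 * k).+1))).
    by move=> m n mn; apply: le_min2 => //; rewrite le_grid// leq_mul2l mn.
  by move=> k; apply: le_min2 => //; rewrite le_grid// mulnS.
have -> : \int[mu]_(u in `]0, t]) dyadicJ u = fine (mu (\bigcup_k I k)).
  by rewrite /Rintegral dyadicJE integral_indic// support_itv.
have muI : mu (\bigcup_k I k) \is a fin_num.
  rewrite ge0_fin_numE// -support_itv//.
  apply: (le_lt_trans (y := mu `]0, t]%classic)).
    by apply: le_measure; rewrite ?inE//; exact: measurableI.
  by rewrite /mu lebesgue_stieltjes_measure_itv// ltry.
suff : EFin \o series (dyadic_incr p t) @ \oo --> (fine (mu (\bigcup_k I k)))%:E.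
  by move=> /fine_cvg.
have -> : EFin \o series (dyadic_incr p t) = (fun n => \sum_(0 <= k < n) mu (I k))%E.
  apply/funext => n; rewrite /series/= -sumEFin; apply: eq_bigr => k _.
  by rewrite /mu lebesgue_stieltjes_measure_itv// le_min2// le_grid.
by rewrite fineK//; exact: measure_semi_sigma_additive.
Qed.

(** The increments of [p - q] are those of [x], so the value of the integral does
    not depend on the decomposition. *)
Lemma is_LS_integral_cvg (x : R -> R) (t v : R) : 0 <= t ->
  is_LS_integral dyadicJ x t v -> series (dyadic_incr x t) @ \oo --> v.
Proof.
move=> t0 [p [q [xpq _ _ ->]]].
have -> : series (dyadic_incr x t) =
    series (dyadic_incr p t) \- series (dyadic_incr q t).
  apply/funext => n; rewrite /series/= -sumrB; apply: eq_bigr => k _.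
  rewrite /dyadic_incr.
  have tk j : 0 <= Num.min t (grid j) <= t.
    by rewrite le_min t0 grid_ge0 ge_min lexx.
  by rewrite !xpq//; ring.
by apply: cvgB; exact: cvg_dyadic_incr.
Qed.

Lemma LS_integral_dyadicJ (x : R -> R) (p q : cumulative R R) (t : R) (n : nat) :
  0 <= t -> (forall u, 0 <= u <= t -> x u = p u - q u) ->
  (forall k, (n <= k)%N -> dyadic_incr x t k = 0) ->
  LS_integral dyadicJ x t = \sum_(k < n) dyadic_incr x t k.
Proof.
move=> t0 xpq x0.
have xn : series (dyadic_incr x t) @ \oo --> \sum_(k < n) dyadic_incr x t k.
  apply: cvg_near_cst; exists n => // m /= nm.
  rewrite /series/= (big_cat_nat (leq0n n) nm)//= big_mkord.
  rewrite [X in _ + X]big_nat_cond [X in _ + X]big1 ?addr0//.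
  by move=> k; rewrite andbT => /andP[nk _]; exact: x0.
have uniq v' : is_LS_integral dyadicJ x t v' -> v' = \sum_(k < n) dyadic_incr x t k.
  by move=> /(is_LS_integral_cvg t0) xv'; exact: cvg_unique xv' xn.
apply: uniq; apply: xgetPex.
exists (\int[lebesgue_stieltjes_measure p]_(u in `]0, t]) dyadicJ u
   - \int[lebesgue_stieltjes_measure q]_(u in `]0, t]) dyadicJ u).
by exists p, q; split=> //; exact: integrable_dyadicJ.
Qed.

End dyadic_integral.

(** * Paths with a single jump *)

Section single_jump_path.
Context {R : realType}.

Lemma cumulative_of (f : R -> R) : nondecreasing f -> right_continuous f ->
  exists p : cumulative R R, p =1 f.
Proof.
move=> fnd frc.
pose p : cumulative R R := HB.pack f (isCumulative.Build R _ R f fnd frc).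
by exists p.
Qed.

Definition nondecreasing_rc01 (F : R -> R) : Prop :=
  [/\ forall s t : R, 0 <= s -> s <= t -> t < 1 -> F s <= F t
    & forall t : R, 0 <= t < 1 -> F u @[u --> t^'+] --> F t].

Lemma stopped_cumulative (F : R -> R) (c : R) : nondecreasing_rc01 F -> 0 <= c < 1 ->
  exists p : cumulative R R, forall u, p u = F (Num.min (Num.max u 0) c).
Proof.
move=> [Fnd Frc] /andP[c0 c1].
apply: cumulative_of => [s t st|t].
  apply: Fnd.
  - by rewrite le_min c0 le_max lexx orbT.
  - by rewrite le_min2// le_max2.
  - by rewrite gt_min c1 orbT.
have [t0|t0] := ltP t 0.
  apply: cvg_near_cst; near=> u.
  have u0 : u <= 0 by near: u; exact: nbhs_right_le.
  by rewrite (max_r u0).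
have [tc|ct] := ltP t c.
  apply: cvg_trans (Frc t _); last by rewrite t0 (lt_trans tc).
  apply: near_eq_cvg; near=> u.
  have tu : t <= u by near: u; exact: nbhs_right_ge.
  have uc : u <= c by near: u; exact: nbhs_right_le.
  by rewrite (max_l (le_trans t0 tu)) (min_l uc).
apply: cvg_near_cst; near=> u.
have tu : t <= u by near: u; exact: nbhs_right_ge.
by rewrite (max_l (le_trans t0 tu)) (min_r (le_trans ct tu)).
Unshelve. all: by end_near. Qed.

Lemma add_jump_cumulative (p : cumulative R R) (g a : R) : 0 <= a ->
  exists q : cumulative R R, forall u, q u = p u + a * (g <= u)%R%:R.
Proof.
move=> a0; apply: cumulative_of => [s t st|t].
  rewrite lerD//; first exact: cumulative_is_nondecreasing.
  rewrite ler_wpM2l// ler_nat.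
  by case: leP => // gs; rewrite (le_trans gs st).
apply: cvgD; first exact: cumulative_is_right_continuous.
have [gt|tg] := leP g t.
  apply: cvg_near_cst; near=> u.
  have tu : t <= u by near: u; exact: nbhs_right_ge.
  by rewrite (le_trans gt tu).
apply: cvg_near_cst; near=> u.
have ug : u < g by near: u; exact: nbhs_right_lt.
by rewrite leNgt ug.
Unshelve. all: by end_near. Qed.

Definition jump_path (F : R -> R) (g a t : R) : R := if t < g then F t else a.

(** If [t < g], the path up to [t] is [F] stopped at [t].  Otherwise it is [F]
    stopped at [g] plus a jump, whose positive part goes to [p] and negative part
    to [q].  Stopping at a time less than 1 keeps away from the possible explosion of [F]
    at 1. *)
Lemma jump_path_cumulative (F : R -> R) (g a t : R) : nondecreasing_rc01 F ->
  0 < g -> 0 <= t -> (t < 1) || (g < 1) ->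
  exists p q : cumulative R R,
    forall u, 0 <= u <= t -> jump_path F g a u = p u - q u.
Proof.
move=> Fnd g0 t0 tg1.
have [z z0] : exists z : cumulative R R, forall u, z u = 0.
  apply: cumulative_of; first by move=> ? ?; rewrite lexx.
  by move=> u; exact: cvg_cst.
have [tg|gt] := ltP t g.
  have t1 : t < 1 by case/orP: tg1 => // /(lt_trans tg).
  have [|p pE] := stopped_cumulative (c := t) Fnd; first by rewrite t0.
  exists p, z => u /andP[u0 ut].
  by rewrite /jump_path (le_lt_trans ut tg) pE z0 subr0 max_l// min_l.
have g1 : g < 1 by case/orP: tg1 => // /(le_lt_trans gt).
have [|p pE] := stopped_cumulative (c := g) Fnd; first by rewrite ltW.
have pos b : 0 <= Num.max b 0 :> R by rewrite le_max lexx orbT.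
have [p' p'E] := add_jump_cumulative p g (pos (a - F g)).
have [q qE] := add_jump_cumulative z g (pos (F g - a)).
exists p', q => u /andP[u0 ut].
rewrite p'E qE pE z0 (max_l u0) add0r /jump_path.
have [ug|gu] := ltP u g; first by rewrite !mulr0 addr0 subr0.
rewrite !mulr1.
have [aF|Fa] := leP a (F g).
  by rewrite max_r ?max_l; lra.
by rewrite max_l ?max_r; lra.
Qed.

(** From [grid (2 * n)] on, either the time [t] is exhausted or the path has
    jumped and is constant: the later increments vanish. *)
Lemma LS_integral_jump_path (F : R -> R) (g a t : R) (n : nat) :
  nondecreasing_rc01 F -> 0 < g -> 0 <= t ->
  (t <= grid (2 * n)) || (g <= grid (2 * n)) ->
  LS_integral dyadicJ (jump_path F g a) t =
  \sum_(k < n) dyadic_incr (jump_path F g a) t k.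
Proof.
move=> Fnd g0 t0 tgn.
have tg1 : (t < 1) || (g < 1).
  by case/orP: tgn => le1; rewrite (le_lt_trans le1) ?grid_lt1// orbT.
have [p [q xpq]] := jump_path_cumulative a Fnd g0 t0 tg1.
apply: (LS_integral_dyadicJ t0 xpq) => k nk; rewrite /dyadic_incr.
have ak : grid (2 * n) <= grid (2 * k) :> R by rewrite le_grid// leq_mul2l nk.
have ab : grid (2 * k) <= grid (2 * k).+1 :> R by rewrite le_grid.
have [tak|akt] := leP t (grid (2 * k)).
  by rewrite min_l ?subrr// (le_trans tak ab).
have ga : g <= grid (2 * k).
  case/orP: tgn => [tn|gn]; last exact: le_trans gn ak.
  by have := lt_le_trans akt (le_trans tn ak); rewrite ltxx.
rewrite /jump_path ltNge le_min (le_trans ga (ltW akt)) (le_trans ga ab)/=.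
by rewrite ltNge ga subrr.
Qed.

End single_jump_path.

(** * Integral inequalities *)

Section dominated.
Import HBNNSimple.
Context {d : measure_display} {T : measurableType d} {R : realType}.
Variable mu : {measure set T -> \bar R}.

(** The integral of [f] is the supremum of the integrals of the simple functions
    below it, and these can be compared with [g].  This serves for the supremum
    of a process over an uncountable set of times, which may not be measurable. *)
Lemma ae_ge0_le_integral_dominated (f g : T -> \bar R) :
  (forall x, 0 <= f x)%E -> (forall x, 0 <= g x)%E ->
  measurable_fun [set: T] g -> {ae mu, forall x, (f x <= g x)%E} ->
  (\int[mu]_x f x <= \int[mu]_x g x)%E.
Proof.
move=> f0 g0 mg fg; rewrite (ge0_integralTE _ f0).
apply: ge_ereal_sup => _ [h hf <-].
rewrite -integralT_nnsfun; apply: ae_ge0_le_integral => //.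
- by move=> x _; rewrite lee_fin; exact: fun_ge0.
- exact/measurable_EFinP.
- by apply: filterS fg => x fgx _; exact: le_trans (hf x) fgx.
Qed.

Lemma ge0_integral_ge_cst (C E : set T) (W : T -> \bar R) (r : R) :
  measurable C -> measurable E -> C `<=` E ->
  measurable_fun [set: T] W -> (forall x, 0 <= W x)%E ->
  (forall x, C x -> (r%:E <= W x)%E) ->
  (r%:E * mu C <= \int[mu]_(x in E) W x)%E.
Proof.
move=> mC mE CE mW W0 rW.
have WE : measurable_fun E W by exact: measurable_funTS.
have [r0|r0] := leP 0 r; last first.
  apply: (@le_trans _ _ 0%E); last exact: integral_ge0.
  by rewrite mule_le0_ge0// lee_fin ltW.
apply: (@le_trans _ _ (\int[mu]_(x in C) W x)%E); last first.
  exact: ge0_subset_integral.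
rewrite -integral_cst//; apply: ge0_le_integral => //.
exact: measurable_funTS.
Qed.

End dominated.

(** * Single jump processes *)

Section single_jump_process.
Context {R : realType} {d : measure_display} {Omega : measurableType d}.
Variables (P : probability Omega R) (F : R -> R) (gamma A : Omega -> R).
Hypothesis Fnd : nondecreasing_rc01 F.
Hypothesis F0 : 0 <= F 0.
Hypothesis mgamma : measurable_fun [set: Omega] gamma.
Hypothesis gamma_gt0 : forall w, 0 < gamma w.
Hypothesis gamma_itv : forall a b : R, 0 <= a -> a <= b -> b <= 1 ->
  P (gamma @^-1` `]a, b]%classic) = (b - a)%:E.

Let X (t : R) (w : Omega) : R := jump_path F (gamma w) (A w) t.

Let F_ge0 t : 0 <= t < 1 -> 0 <= F t.
Proof. by case: Fnd => Fh _ /andP[t0 t1]; rewrite (le_trans F0)// Fh. Qed.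

Let measurable_gamma_itv (i : interval R) : measurable (gamma @^-1` [set` i]).
Proof.
rewrite -[X in measurable X]setTI.
by apply: mgamma => //; exact: measurable_itv.
Qed.

Lemma gamma_lt1 : {ae P, forall w, gamma w < 1}.
Proof.
exists (gamma @^-1` `[1, +oo[%classic); split.
- exact: measurable_gamma_itv.
- apply/eqP; rewrite eq_le measure_ge0 andbT leNgt; apply/negP => P0.
  have PN : P (gamma @^-1` `[1, +oo[%classic) \is a fin_num.
    by rewrite fin_num_measure//; exact: measurable_gamma_itv.
  have PN0 : 0 < fine (P (gamma @^-1` `[1, +oo[%classic)).
    by rewrite fine_gt0// P0 ltey_eq PN.
  have [n gn] : exists n, 1 - fine (P (gamma @^-1` `[1, +oo[%classic)) < grid n.
    by apply: grid_gt; lra.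
  suff : fine (P (gamma @^-1` `[1, +oo[%classic)) <= 1 - grid n by lra.
  have gi := @gamma_itv 0 (grid n) (lexx _) (grid_ge0 n) (ltW (grid_lt1 n)).
  rewrite -lee_fin fineK// EFinB -[grid n]subr0 -gi.
  rewrite -probability_setC; last exact: measurable_gamma_itv.
  apply: le_measure; rewrite ?inE.
  + exact: measurable_gamma_itv.
  + by apply: measurableC; exact: measurable_gamma_itv.
  + move=> w /=; rewrite !in_itv/= andbT => g1 /andP[_ wn].
    by have := le_lt_trans (le_trans g1 wn) (grid_lt1 n); rewrite ltxx.
- by move=> w /= /negP; rewrite -leNgt in_itv/= andbT.
Qed.

(** Almost surely [gamma < 1], and then the supremum of the path is at most the
    maximum of [`|X 1|] and of the supremum of [F] before [gamma]. *)
Lemma H1_of_dominated Fs (psi : Omega -> \bar R) :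
  martingale_wrt P Fs 1 X -> measurable_fun [set: Omega] psi ->
  (forall w, 0 <= psi w)%E -> (\int[P]_w psi w < +oo)%E ->
  (forall w t, gamma w < 1 -> 0 <= t < gamma w -> ((F t)%:E <= psi w)%E) ->
  H1_martingale_wrt P Fs 1 X.
Proof.
move=> MX mpsi psi0 ipsi Fpsi; split=> //.
have iX : P.-integrable setT (EFin \o X 1).
  by case: MX => _ _ + _; apply; rewrite ler01 lexx.
have mX1 := measurable_int P iX.
have mabs : measurable_fun setT (fun w => `|X 1 w|%:E).
  by apply/measurable_EFinP; apply: measurableT_comp => //; exact/measurable_EFinP.
apply: (@le_lt_trans _ _ (\int[P]_w (`|X 1 w|%:E + psi w))%E); last first.
  rewrite ge0_integralD//.
  by apply: lte_add_pinfty => //; case/integrableP: iX.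
apply: ae_ge0_le_integral_dominated => //.
- move=> w; apply: (@le_trans _ _ (`|X 0 w|%:E)); first by rewrite lee_fin.
  by apply: ereal_sup_ubound; exists 0 => //=; rewrite lexx ler01.
- by move=> w; rewrite adde_ge0// lee_fin.
- exact: emeasurable_funD.
- apply: filterS gamma_lt1 => w g1; apply: ge_ereal_sup => _ [t /= /andP[t0 t1] <-].
  rewrite {1}/X /jump_path; case: ltP => tg.
    rewrite ger0_norm ?F_ge0 ?t0 ?(lt_trans tg)//.
    by rewrite (le_trans (Fpsi w t g1 _)) ?t0// leeDr// lee_fin.
  rewrite /X /jump_path ltNge (ltW g1)/=.
  by rewrite leeDl.
Qed.

Lemma unbounded_of_notH1 Fs : martingale_wrt P Fs 1 X ->
  ~ H1_martingale_wrt P Fs 1 X -> forall c, exists n, c < F (grid (2 * n)).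
Proof.
move=> MX nH1 c; apply: contrapT => Fc; apply: nH1.
have cF n : F (grid (2 * n)) <= c.
  by rewrite leNgt; apply/negP => ?; apply: Fc; exists n.
have c0 : 0 <= c by rewrite (le_trans F0)// -(grid0 (R := R)) (cF 0).
apply: (@H1_of_dominated _ (cst c%:E)) => //.
- by rewrite integral_cst//= probability_setT mule1 ltry.
- move=> w t g1 /andP[t0 tg]; rewrite lee_fin.
  have [n tn] := grid_gt (lt_trans tg g1).
  rewrite (le_trans _ (cF n))//; case: Fnd => Fh _; apply: Fh => //.
    by rewrite (le_trans (ltW tn))// le_grid// leq_pmull.
  exact: grid_lt1.
Qed.

(** An event observable at time [grid (2 * n)] in every filtration to which [X] is
    adapted, and on which the jump has certainly occurred by then; the event
    [gamma <= grid (2 * n)] itself need not be observable. *)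
Let exit (n : nat) (w : Omega) : bool :=
  ~~ [forall k : 'I_n.+1, X (grid (2 * k)) w == F (grid (2 * k))].

Let tau (n : nat) (w : Omega) : R := if exit n w then 1 else grid (2 * n).

Let exit_le m n w : (m <= n)%N -> exit m w -> exit n w.
Proof.
move=> mn; rewrite /exit !negb_forall => /existsP[k Xk].
by apply/existsP; exists (widen_ord (mn : (m.+1 <= n.+1)%N) k).
Qed.

Let exit_gamma n w : exit n w -> gamma w <= grid (2 * n).
Proof.
rewrite /exit negb_forall => /existsP[k]; rewrite /X /jump_path.
case: ltP => [_|gk _]; first by rewrite eqxx.
by rewrite (le_trans gk)// le_grid// leq_mul2l -ltnS ltn_ord.
Qed.

Let exitE n : [set w | exit n w] =
  ~` \bigcap_(k in [set k | (k <= n)%N])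
       (X (grid (2 * k)) @^-1` [set F (grid (2 * k))]).
Proof.
apply/seteqP; split=> w /=; rewrite /exit.
  move=> /negP nX capX; apply: nX; apply/forallP => k; apply/eqP/capX.
  by rewrite /= -ltnS.
move=> ncap; apply/negP => /forallP /= allX; apply: ncap => k /= kn.
by have /eqP := allX (Ordinal (kn : (k < n.+1)%N)).
Qed.

(** If [exit n w] holds, the path is constant after [grid (2 * n)], so that not
    stopping at all has the same effect as stopping at [grid (2 * n)]. *)
Let stopped_stoch_integral n t w : 0 <= t <= 1 ->
  stopped (stoch_integral dyadicJ X) (tau n) t w =
  \sum_(k < n) dyadic_incr (X ^~ w) t k.
Proof.
move=> /andP[t0 t1]; rewrite /stopped /stoch_integral /tau.
case: ifPn => [en|_].
  by rewrite min_l// (@LS_integral_jump_path _ _ _ _ _ n)// exit_gamma ?orbT.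
rewrite (@LS_integral_jump_path _ _ _ _ _ n)//; last 2 first.
- by rewrite le_min t0 grid_ge0.
- by rewrite ge_min lexx orbT.
apply: eq_bigr => k _; rewrite /dyadic_incr -!minA.
have kn : ((2 * k).+1 <= 2 * n)%N by rewrite ltn_mul2l ltn_ord.
by rewrite (min_r (le_grid kn)) (min_r (le_grid (ltnW kn))).
Qed.

Lemma local_martingale_stoch_integral Fs : is_filtration Fs ->
  martingale_wrt P Fs 1 X -> (forall c, exists n, c < F (grid (2 * n))) ->
  local_martingale_wrt P Fs 1 (stoch_integral dyadicJ X).
Proof.
move=> Ffs MX Foo; case: (Ffs) => sF mF ndF.
have exitF n : Fs (grid (2 * n)) [set w | exit n w].
  rewrite exitE; set S := Fs _.
  have sS : sigma_algebra setT S by exact: (sF _ (grid_ge0 _)).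
  rewrite -(sigma_algebra_id sS).
  apply: (@measurableC _ (g_sigma_algebraType S)).
  apply: (@bigcap_measurableType _ (g_sigma_algebraType S)) => k /= kn.
  apply: sub_sigma_algebra; apply: (ndF (grid (2 * k))) => //.
  - exact: grid_ge0.
  - by rewrite le_grid// leq_mul2l kn.
  - case: MX => _ + _ _; apply; last exact: measurable_set1.
    by rewrite grid_ge0 ltW// grid_lt1.
have setCF t E : 0 <= t -> Fs t E -> Fs t (~` E).
  by move=> t0; rewrite -setTD; case: (sF _ t0) => _ + _; apply.
exists tau; split.
- move=> n w; rewrite /tau; case: ifPn => _; first by rewrite ler01 lexx.
  by rewrite grid_ge0 ltW// grid_lt1.
- move=> n w; rewrite /tau; case: ifPn => [en|_].
    by rewrite (exit_le (leqnSn n) en).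
  case: ifPn => _; first by rewrite ltW// grid_lt1.
  by rewrite le_grid// leq_mul2l leqnSn.
- move=> n t t0; have [t1|t1] := leP 1 t.
    rewrite [X in Fs t X](_ : _ = setT).
      by rewrite -setC0; apply: setCF => //; case: (sF _ t0).
    apply/seteqP; split=> // w _ /=; rewrite (le_trans _ t1)// /tau.
    by case: ifPn => // _; rewrite ltW// grid_lt1.
  have [tn|nt] := ltP t (grid (2 * n)).
    rewrite [X in Fs t X](_ : _ = set0); first by case: (sF _ t0).
    rewrite -subset0 => w /=; rewrite /tau; case: ifPn => _.
      by rewrite leNgt t1.
    by rewrite leNgt tn.
  apply: (ndF (grid (2 * n))) => //; first exact: grid_ge0.
  rewrite [X in Fs _ X](_ : _ = ~` [set w | exit n w]).
    exact: (setCF _ _ (grid_ge0 _) (exitF n)).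
  apply/seteqP; split=> w /=; rewrite /tau; case: ifPn => //.
  by rewrite leNgt t1.
- move=> n; pose Z k t w := dyadic_incr (X ^~ w) t k.
  apply: (@eq_martingale_wrt _ _ _ _ _ _ (fun t w => \sum_(k < n) Z k t w)) => //.
    by move=> t w t01; rewrite stopped_stoch_integral.
  apply: martingale_wrt_sum => // k _.
  have Mstop j := martingale_wrt_stop Ffs (grid_ge0 j) MX.
  have := martingale_wrt_addZ (-1) Ffs (Mstop (2 * k).+1) (Mstop (2 * k)%N).
  by apply: eq_martingale_wrt => // t w _; rewrite /Z /dyadic_incr mulN1r.
- have tauE n : [set w | tau n w = 1] = [set w | exit n w].
    apply/seteqP; split=> w /=; rewrite /tau; case: ifPn => // _ /eqP.
    by rewrite lt_eqF// grid_lt1.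
  have -> : (fun n => P [set w | tau n w = 1]) =
      P \o (fun n => [set w | exit n w]) by apply/funext => n /=; rewrite tauE.
  have mexit n : measurable [set w | exit n w].
    exact: (mF _ (grid_ge0 _) _ (exitF n)).
  have mU : measurable (\bigcup_n [set w | exit n w]).
    exact: bigcupT_measurable.
  rewrite -(_ : P (\bigcup_n [set w | exit n w]) = 1%E); last first.
    (* after the jump the path stays at A w, which F exceeds eventually *)
    have Uae : {ae P, forall w, (\bigcup_n [set w | exit n w]) w}.
      apply: filterS gamma_lt1 => w g1.
      have [n1 gn1] := grid_gt g1; have [n2 An2] := Foo (A w).
      pose n := maxn n1 n2; exists n => //=; rewrite /exit negb_forall.
      apply/existsP; exists ord_max; rewrite /X /jump_path.
      have -> : (grid (2 * @ord_max n) < gamma w) = false.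
        apply/negbTE; rewrite -leNgt (le_trans (ltW gn1))// le_grid//.
        by rewrite (leq_trans (leq_maxl n1 n2))// leq_pmull.
      rewrite lt_eqF// (lt_le_trans An2)//; case: Fnd => Fh _; apply: Fh.
      - exact: grid_ge0.
      - by rewrite le_grid// leq_mul2l leq_maxr.
      - exact: grid_lt1.
    have := probability_setC P (measurableC mU).
    rewrite setCK => ->; rewrite (negligibleP _ _).1 ?sube0//.
    exact: measurableC.
  apply: nondecreasing_cvg_mu => // m n mn; apply/subsetPset => w; exact: exit_le.
Qed.

(** The value of the integral at time [grid (2 * k)] if the jump comes later. *)
Let h (k : nat) : R := \sum_(j < k) (F (grid (2 * j).+1) - F (grid (2 * j))).

Let h_nd k : h k <= h k.+1.
Proof.
rewrite /h big_ord_recr/= lerDl subr_ge0; case: Fnd => Fh _; apply: Fh.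
- exact: grid_ge0.
- exact: le_grid.
- exact: grid_lt1.
Qed.

Let sum_incr_before k w : grid (2 * k) < gamma w ->
  \sum_(j < k) dyadic_incr (X ^~ w) 1 j = h k.
Proof.
move=> kg; apply: eq_bigr => j _; rewrite /dyadic_incr.
have jk : ((2 * j).+1 <= 2 * k)%N by rewrite ltn_mul2l ltn_ord.
rewrite (min_r (ltW (grid_lt1 _))) (min_r (ltW (grid_lt1 _))) /X /jump_path.
by rewrite (le_lt_trans (le_grid jk) kg) (le_lt_trans (le_grid (ltnW jk)) kg).
Qed.

Let stoch_integral_at1 n w : gamma w <= grid (2 * n) ->
  stoch_integral dyadicJ X 1 w = \sum_(k < n) dyadic_incr (X ^~ w) 1 k.
Proof. by move=> gn; apply: LS_integral_jump_path => //; rewrite gn orbT. Qed.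

Let stoch_integral_odd k w : grid (2 * k).+1 < gamma w <= grid (2 * k.+1) ->
  stoch_integral dyadicJ X 1 w = h k.+1.
Proof.
move=> /andP[kg gk]; rewrite (stoch_integral_at1 gk) big_ord_recr/=.
have kg' : grid (2 * k) < gamma w by rewrite (le_lt_trans (le_grid (leqnSn _)) kg).
rewrite (sum_incr_before kg') /h big_ord_recr/=; congr (_ + _).
rewrite /dyadic_incr (min_r (ltW (grid_lt1 _))) (min_r (ltW (grid_lt1 _))).
by rewrite /X /jump_path kg kg'.
Qed.

Let stoch_integral_even k w : grid (2 * k) < gamma w <= grid (2 * k).+1 ->
  stoch_integral dyadicJ X 1 w = h k + (X 1 w - F (grid (2 * k))).
Proof.
move=> /andP[kg gk].
have gk' : gamma w <= grid (2 * k.+1) by rewrite (le_trans gk)// le_grid// mulnS.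
rewrite (stoch_integral_at1 gk') big_ord_recr/= (sum_incr_before kg).
rewrite /dyadic_incr (min_r (ltW (grid_lt1 _))) (min_r (ltW (grid_lt1 _))).
rewrite /X /jump_path kg ltNge gk/= ltNge.
by rewrite (le_trans gk (ltW (grid_lt1 _))).
Qed.

Let gridB1 k : grid (2 * k).+1 - grid (2 * k) = 2 ^- (2 * k) / 2 :> R.
Proof. by rewrite /grid exprSr invfM; field; rewrite expf_neq0. Qed.

Let gridB2 k : grid (2 * k.+1) - grid (2 * k).+1 = 2 ^- (2 * k) / 4 :> R.
Proof. by rewrite /grid mulnS !exprS; field; rewrite expf_neq0. Qed.

(** The alternation of the integrand transfers integrability in two steps: from
    [N 1] to [h] on the intervals where the integrand is 0, then from [h] to [F] on
    those where it is 1. *)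
Lemma H1_of_integrable_stoch_integral Fs : martingale_wrt P Fs 1 X ->
  P.-integrable [set: Omega] (EFin \o stoch_integral dyadicJ X 1) ->
  H1_martingale_wrt P Fs 1 X.
Proof.
move=> MX iN.
have iX : P.-integrable setT (EFin \o X 1).
  by case: MX => _ _ + _; apply; rewrite ler01 lexx.
pose W w := (`|stoch_integral dyadicJ X 1 w|%:E + `|X 1 w|%:E)%E.
have [mN fN] := integrableP _ _ _ iN; have [mX fX] := integrableP _ _ _ iX.
have mabs (Y : Omega -> R) : measurable_fun setT (EFin \o Y) ->
    measurable_fun setT (fun w => `|Y w|%:E).
  move=> mY; apply/measurable_EFinP; apply: measurableT_comp => //.
  exact/measurable_EFinP.
have mW : measurable_fun setT W by apply: emeasurable_funD; exact: mabs.
have W0 w : (0 <= W w)%E by rewrite adde_ge0// lee_fin.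
have iW : (\int[P]_w W w < +oo)%E.
  rewrite ge0_integralD//; [exact: lte_add_pinfty|exact: mabs|exact: mabs].
pose E k := gamma @^-1` `]grid (2 * k), grid (2 * k.+1)]%classic.
have mE k : measurable (E k) by exact: measurable_gamma_itv.
have tE : trivIset setT E.
  move=> i j _ _ [w [Ei Ej]].
  apply: (@trivIset_itv_oc _ (fun k => grid (2 * k))
    (fun k => grid (2 * k.+1))) => //.
    by move=> m n mn; rewrite le_grid// leq_mul2l mn.
  by exists (gamma w).
(* If c is the integral of W over E k and e = 2 ^- (2 * k), then B1 and B2 give
   F e <= 2 c + h_k e and h_k e <= h_(k+1) e <= 4 c. *)
have key k : ((F (grid (2 * k)) * 2 ^- (2 * k))%:E
    <= 6%:E * \int[P]_(w in E k) W w)%E.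
  have le12 : grid (2 * k) <= grid (2 * k).+1 :> R by exact: le_grid.
  have le23 : grid (2 * k).+1 <= grid (2 * k.+1) :> R by rewrite le_grid// mulnS.
  have Efin : (\int[P]_(w in E k) W w)%E \is a fin_num.
    rewrite ge0_fin_numE ?integral_ge0//; apply: le_lt_trans iW.
    exact: ge0_subset_integral.
  have B1 : (((F (grid (2 * k)) - h k) * (2 ^- (2 * k) / 2))%:E
      <= \int[P]_(w in E k) W w)%E.
    rewrite EFinM -gridB1 -(gamma_itv (grid_ge0 _) le12 (ltW (grid_lt1 _))).
    apply: ge0_integral_ge_cst => //.
    + by move=> w; rewrite /E /= !in_itv/= => /andP[-> /le_trans ->].
    + move=> w /=; rewrite in_itv/= => gw.
      rewrite /W (stoch_integral_even gw) -EFinD lee_fin.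
      set a := X 1 w; set b := F _.
      have -> : b - h k = a - (h k + (a - b)) by ring.
      by rewrite (le_trans (ler_norm _))// (le_trans (ler_normB _ _))// addrC.
  have B2 : ((h k.+1 * (2 ^- (2 * k) / 4))%:E <= \int[P]_(w in E k) W w)%E.
    rewrite EFinM -gridB2 -(gamma_itv (grid_ge0 _) le23 (ltW (grid_lt1 _))).
    apply: ge0_integral_ge_cst => //.
    + move=> w; rewrite /E /= !in_itv/= => /andP[gw ->].
      by rewrite (le_lt_trans le12 gw).
    + move=> w /=; rewrite in_itv/= => gw.
      rewrite /W (stoch_integral_odd gw) -EFinD lee_fin.
      by rewrite (le_trans (ler_norm _))// lerDl.
  move: B1 B2; rewrite -(fineK Efin) -EFinM !lee_fin.
  have e0 : 0 < 2 ^- (2 * k) :> R by rewrite invr_gt0 exprn_gt0.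
  have := h_nd k; nra.
(* On E k the bound is the value of F at the right endpoint, which key controls
   through the integral of W over the next interval E k.+1. *)
pose psi w := (\sum_(0 <= k <oo) (F (grid (2 * k.+1)) * \1_(E k) w)%:E)%E.
have Fg k : 0 <= F (grid (2 * k)) by rewrite F_ge0// grid_ge0 grid_lt1.
have psik0 k w : (0 <= (F (grid (2 * k.+1)) * \1_(E k) w)%:E)%E.
  by rewrite lee_fin mulr_ge0.
have mpsik k :
    measurable_fun setT (fun w => (F (grid (2 * k.+1)) * \1_(E k) w)%:E).
  by apply/measurable_EFinP; apply: measurable_funM.
apply: (@H1_of_dominated _ psi) => //.
- by apply: ge0_emeasurable_sum => // k w _ _; exact: psik0.
- by move=> w; apply: nneseries_ge0 => k _ _; exact: psik0.
- rewrite integral_nneseries//.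
  apply: (@le_lt_trans _ _
    (\sum_(0 <= k <oo) (18%:E * \int[P]_(w in E k.+1) W w))%E).
    apply: lee_nneseries => [k _ _|k _]; first exact: integral_ge0.
    under eq_integral do rewrite EFinM.
    rewrite ge0_integralZl_EFin//; [|by apply/measurable_EFinP; exact: measurable_indic].
    have PE : P (E k) = (grid (2 * k.+1) - grid (2 * k))%:E.
      apply: gamma_itv; [exact: grid_ge0| |exact/ltW/grid_lt1].
      by rewrite le_grid// leq_mul2l leqnSn.
    rewrite integral_indic// setIT [X in (_ * X)%E]PE.
    (* E k has length 2 ^- (2 * k) * 3 / 4, which is 3 * 2 ^- (2 * k.+1). *)
    rewrite -EFinM (_ : _ * _ = 3 * (F (grid (2 * k.+1)) * 2 ^- (2 * k.+1))).
      have -> : (18%:E = 3%:E * 6%:E :> \bar R)%E.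
        by rewrite -EFinM; congr EFin; ring.
      by rewrite EFinM -muleA lee_wpmul2l.
    by rewrite /grid mulnS !exprS; field; rewrite expf_neq0.
  rewrite nneseriesZl; last by move=> k _; exact: integral_ge0.
  rewrite -ge0_integral_bigcup//; last 2 first.
  + exact: measurable_funTS.
  + by move=> i j _ _ ij; apply: (succn_inj); exact: tE.
  apply: lte_mul_pinfty => //.
  apply: le_lt_trans iW; apply: ge0_subset_integral => //.
  exact: bigcupT_measurable.
- move=> w t g1 /andP[t0 tg].
  have exn : exists n, gamma w <= grid (2 * n).
    have [n gn] := grid_gt g1; exists n; rewrite (le_trans (ltW gn))//.
    by rewrite le_grid// leq_pmull.
  case: (ex_minnP exn) => -[|k]; first by rewrite muln0 grid0 leNgt gamma_gt0.
  move=> gk kmin.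
  have kg : grid (2 * k) < gamma w.
    by rewrite ltNge; apply/negP => /kmin; rewrite ltnn.
  apply: (@le_trans _ _
    (\sum_(0 <= j < k.+1) (F (grid (2 * j.+1)) * \1_(E j) w)%:E)%E).
    rewrite big_nat_recr//= -[leLHS]add0e; apply: leeD.
      by apply: sume_ge0 => j _; exact: psik0.
    rewrite indicE mem_set ?mulr1 ?lee_fin; last by rewrite /E/= in_itv/= kg gk.
    case: Fnd => Fh _; apply: Fh => //; last exact: grid_lt1.
    exact: le_trans (ltW tg) gk.
  exact: (nneseries_lim_ge k.+1 (fun j _ _ => psik0 j w)).
Qed.

End single_jump_process.

(** * Regularity of the data *)

Section data.
Context {R : realType} {d : measure_display} {Omega : measurableType d}.
Variable P : probability Omega R.

Lemma uniform_itv (gamma : {RV P >-> R}) :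
  (forall t : R, cdf gamma t = (unifG t)%:E) ->
  forall a b : R, 0 <= a -> a <= b -> b <= 1 ->
    P (gamma @^-1` `]a, b]%classic) = (b - a)%:E.
Proof.
move=> gamma_cdf a b a0 ab b1.
have Pc t : 0 <= t <= 1 -> P (gamma @^-1` `]-oo, t]%classic) = t%:E.
  move=> /andP[t0 t1]; have := gamma_cdf t.
  by rewrite unifGE (min_l t1) (max_r t0).
have mi (i : interval R) : measurable (gamma @^-1` [set` i]).
  rewrite -[X in measurable X]setTI.
  exact: (measurable_funPT gamma measurableT _ (measurable_itv i)).
have -> : gamma @^-1` `]a, b]%classic =
    gamma @^-1` `]-oo, b]%classic `\` gamma @^-1` `]-oo, a]%classic.
  apply/seteqP; split=> w /=; rewrite !in_itv/=.
    by move=> /andP[aw ->]; split=> //; apply/negP; rewrite -ltNge.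
  by move=> [-> /negP]; rewrite -ltNge => ->.
rewrite measureD//; last by rewrite ltey_eq fin_num_measure.
rewrite (_ : _ `&` _ = gamma @^-1` `]-oo, a]%classic).
  rewrite [X in (X - _)%E]Pc ?(le_trans a0 ab)// [X in (_ - X)%E]Pc//.
  by rewrite a0 (le_trans ab b1).
apply/seteqP; split=> w /=; rewrite !in_itv/=; first by case.
by move=> wa; split=> //; exact: le_trans ab.
Qed.

(** Right-continuity is read off the sample paths: [t < gamma] has positive
    probability for [t < 1], hence some path is cadlag and coincides with [F]
    beyond [t].  Right-continuity at 0 extends the monotonicity to the origin. *)
Lemma nondecreasing_rc01_martingale (F : R -> R) (gamma A : Omega -> R)
    (Fs : R -> set (set Omega)) :
  measurable_fun [set: Omega] gamma ->
  (forall a b : R, 0 <= a -> a <= b -> b <= 1 ->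
    P (gamma @^-1` `]a, b]%classic) = (b - a)%:E) ->
  {in `]0, 1[ &, {homo F : x y / x <= y}} ->
  martingale_wrt P Fs 1 (fun t w => jump_path F (gamma w) (A w) t) ->
  nondecreasing_rc01 F.
Proof.
move=> mg g_itv F_nd MX.
have Frc t : 0 <= t < 1 -> F u @[u --> t^'+] --> F t.
  move=> /andP[t0 t1].
  have [w [tw cw]] : exists w, t < gamma w /\
      cadlag_on 1 (fun u => jump_path F (gamma w) (A w) u).
    apply: contrapT => noex.
    have Pt0 : P (gamma @^-1` `]t, 1]%classic) = 0%E.
      apply/negligibleP.
        rewrite -[X in measurable X]setTI.
        by apply: mg => //; exact: measurable_itv.
      case: MX => cX _ _ _; apply: negligibleS cX => w /=.
      by rewrite in_itv/= => /andP[tw _] cw; apply: noex; exists w.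
    move: Pt0; rewrite (g_itv _ _ t0 (ltW t1) (lexx _)) => -[].
    by apply/eqP; rewrite subr_eq0 gt_eqF.
  have := cw.1 t; rewrite t0 t1 {2}/jump_path tw => /(_ isT).
  apply: cvg_trans; apply: near_eq_cvg; near=> u.
  have uw : u < gamma w by near: u; exact: nbhs_right_lt.
  by rewrite /jump_path uw.
split=> // s t s0 st t1.
have := s0; rewrite le_eqVlt => /orP[/eqP <-|s_gt0]; last first.
  by apply: F_nd => //; rewrite in_itv/= ?s_gt0 ?(lt_le_trans s_gt0) ?(le_lt_trans st).
have := le_trans s0 st; rewrite le_eqVlt => /orP[/eqP <-//|t_gt0].
have F0c : F u @[u --> 0^'+] --> F 0 by apply: Frc; rewrite lexx ltr01.
rewrite leNgt; apply/negP => Ft.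
have [u [[u0 ut] Fu]] := filter_ex (filterI
  (filterI (nbhs_right_gt 0) (nbhs_right_le t_gt0)) (cvgr_gt _ F0c _ Ft)).
move: Fu; apply/negP; rewrite -leNgt; apply: F_nd => //; rewrite in_itv/=.
  by rewrite u0 (le_lt_trans ut).
by rewrite t_gt0.
Unshelve. all: by end_near. Qed.

End data.

Theorem theorem4p2 (R : realType) (d : measure_display)
    (Omega : measurableType d) (P : probability Omega R)
    (gamma : {RV P >-> R})
    (gamma_gt0 : forall w, 0 < gamma w)
    (gamma_cdf : forall t : R, cdf gamma t = (unifG t)%:E)
    (F dFdG : R -> R)
    (F_ac : loc_abs_cont unifG F)
    (dFdG_density : is_local_density unifG F dFdG)
    (M_martingale : martingale P 1 (MG unifG F dFdG gamma))
    (M_notH1 : ~ H1_martingale P 1 (MG unifG F dFdG gamma))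
    (F_nd : {in `]0, 1[ &, {homo F : x y / x <= y}})
    (F0 : F 0 = 0) :
  strict_local_martingale P 1
    (stoch_integral dyadicJ (MG unifG F dFdG gamma)).
Proof.
pose A w := AG unifG F dFdG (gamma w).
have XE : MG unifG F dFdG gamma = fun t w => jump_path F (gamma w) (A w) t.
  apply/funext => t; apply/funext => w; rewrite /MG /jump_path.
  by case: ltP => _; rewrite ?mulr1 ?mulr0 ?addr0 ?add0r.
have mg : measurable_fun [set: Omega] gamma by [].
have g_itv := uniform_itv gamma_cdf.
case: M_martingale => Fs [Ffs MX]; rewrite XE in MX.
have nH1 :
    ~ H1_martingale_wrt P Fs 1 (fun t w => jump_path F (gamma w) (A w) t).
  by move=> H1; apply: M_notH1; exists Fs; rewrite XE.
have Fnd := nondecreasing_rc01_martingale mg g_itv F_nd MX.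
have F0ge : 0 <= F 0 by rewrite F0.
rewrite XE; split.
  exists Fs; split=> //.
  apply: (local_martingale_stoch_integral Fnd mg gamma_gt0 g_itv Ffs MX).
  exact: (unbounded_of_notH1 Fnd F0ge mg g_itv MX nH1).
move=> [Fs' [_ [_ _ iN _]]]; apply: nH1.
apply: (H1_of_integrable_stoch_integral Fnd F0ge mg gamma_gt0 g_itv MX).
by apply: iN; rewrite ler01 lexx.
Qed.
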